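(* Let $n\ge1$, let $\mathbb{F}_n$ be the free group on generators $g_1,\dots,g_n$, and let $\mathbb{C}[\mathbb{F}_n]$ be its group algebra, with its Hopf algebra structure. The canonical tame calculus on $\mathbb{C}[\mathbb{F}_n]$ is a bicovariant differential calculus. The canonical basis elements $e_1,\dots,e_n$ of its bimodule of one-forms are left invariant and right invariant.
   Context: Write $\mathcal{A}=\mathbb{C}[\mathbb{F}_n]$, with linear basis $\{\delta_g\}_{g\in\mathbb{F}_n}$, involution $\delta_g^*=\delta_{g^{-1}}$ and coproduct $\Delta(\delta_g)=\delta_g\otimes\delta_g$. It is a dense $*$-subalgebra of the reduced group $C^*$-algebra $C^*_r(\mathbb{F}_n)$, generated by the unitaries $S_i=\delta_{g_i}$. The $\mathbb{T}^n$-action $(\lambda_1,\dots,\lambda_n)\cdot S_j=\lambda_jS_j$ yields derivations $\partial_1,\dots,\partial_n$ of $\mathcal{A}$ with $\partial_i(S_j)=\delta_{ij}S_i$ and $\partial_i(S_j^* )=-\delta_{ij}S_j^*$. Canonical tame calculus. Fix a faithful state $\tau_0$ on $A=C^*_r(\mathbb{F}_n)$, let $\mathcal{H}=L^2(A,\tau_0)\otimes\mathbb{C}^N$ with $N=2^{[n/2]}$, $\pi(a)=a\otimes1$, and $\mathcal{D}=\sum_i\partial_i\otimes\gamma_i$, with gamma matrices $\gamma_i$ on $\mathbb{C}^N$: $\gamma_i^2=1$, $\gamma_i\gamma_j=-\gamma_j\gamma_i$ ($i\neq j$). The canonical calculus is Connes' calculus $\Omega^k_{\mathcal{D}}(\mathcal{A})=\Pi(\Omega^k_u(\mathcal{A}))/\Pi(\delta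 J_0^{k-1})$, where $(\Omega^\bullet_u(\mathcal{A}),\delta)$ is the reduced universal differential graded algebra, $\Pi(a_0\delta a_1\cdots\delta a_k)=a_0[\mathcal{D},a_1]\cdots[\mathcal{D},a_k]$, and $J^k_0=\ker\Pi|_{\Omega_u^k(\mathcal{A})}$. Its first-order part is: $\Omega^1_{\mathcal{D}}(\mathcal{A})$ is the free bimodule with central basis $e_i=1\otimes\gamma_i$, and $d(a)=\sum_i\partial_i(a)e_i$ for $a\in\mathcal{A}$. One has $e_i=\delta_{g_i}^*\,d(\delta_{g_i})$. A first order differential calculus $(\Omega^1(\mathcal{A}),d)$ on a Hopf algebra $(\mathcal{A},\Delta)$ is left covariant if, for every finite family $a_k,b_k\in\mathcal{A}$ with $\sum_k a_kd(b_k)=0$, one has $\sum_k\Delta(a_k)(\mathrm{id}\otimes d)\Delta(b_k)=0$ in $\mathcal{A}\otimes\Omega^1(\mathcal{A})$; it is right covariant if for every such family $\sum_k\Delta(a_k)(d\otimes\mathrm{id})\Delta(b_k)=0$ in $\Omega^1(\mathcal{A})\otimes\mathcal{A}$; it is bicovariant if it is both. For a bicovariant calculus, the left and right coactions are $\sum_k a_kd(b_k)\mapsto\sum_k\Delta(a_k)(\mathrm{id}\otimes d)\Delta(b_k)$ and $\sum_k a_kd(b_k)\mapsto\sum_k\Delta(a_k)(d\otimes\mathrm{id})\Delta(b_k)$; a one-form $e$ is left invariant if its image under the left coaction is $1\otimes e$, and right invariant if its image under the right coaction is $e\otimes1$. *)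

(* Defs.v *)
From HB Require Import structures.
From mathcomp Require Import all_boot all_order all_algebra.
From mathcomp Require Import generic_quotient finmap.
From mathcomp Require Import boolp classical_sets functions reals complex.
From mathcomp Require Import monalg.

Set Implicit Arguments.
Unset Strict Implicit.
Unset Printing Implicit Defensive.

Import GRing.Theory.
Local Open Scope ring_scope.
Local Open Scope quotient_scope.

Section LinearFacts.
Variables (K : fieldType) (U V : lmodType K) (f : U -> V).
Hypothesis linf : linear f.

Lemma linP0 : f 0 = 0.
Proof. by have := linf (-1) 0 0; rewrite scaler0 addr0 scaleN1r addNr. Qed.

Lemma linPD u v : f (u + v) = f u + f v.
Proof. by have := linf 1 u v; rewrite !scale1r. Qed.

Lemma linPZ c u : f (c *: u) = c *: f u.
Proof. by have := linf c u 0; rewrite linP0 !addr0. Qed.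

Lemma linPN u : f (- u) = - f u.
Proof. by rewrite -scaleN1r linPZ scaleN1r. Qed.

Lemma linPB u v : f (u - v) = f u - f v.
Proof. by rewrite linPD linPN. Qed.

Lemma linP_sum (I : Type) (r : seq I) (F : I -> U) :
  f (\sum_(i <- r) F i) = \sum_(i <- r) f (F i).
Proof. exact: (big_morph f linPD linP0). Qed.
End LinearFacts.

Lemma lin_comp (K : fieldType) (U V W : lmodType K) (f : U -> V) (g : V -> W) :
  linear f -> linear g -> linear (g \o f).
Proof. by move=> lf lg c u v /=; rewrite lf lg. Qed.

Lemma lin_id (K : fieldType) (U : lmodType K) : linear (@idfun U).
Proof. by []. Qed.

Lemma lin_sumf (K : fieldType) (U V : lmodType K) (I : Type) (r : seq I)
    (F : I -> U -> V) :
  (forall i, linear (F i)) -> linear (fun u => \sum_(i <- r) F i u).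
Proof.
move=> lF c u v; rewrite scaler_sumr -big_split /=.
by apply: eq_bigr => i _; rewrite lF.
Qed.

Definition is_bilinear (K : fieldType) (V W U : lmodType K)
    (f : V -> W -> U) : Prop :=
  (forall w, linear (f^~ w)) /\ (forall v, linear (f v)).

Section Tensor.
Variables (K : fieldType) (V W : lmodType K).

(* The list [:: (v1, w1); ...; (vk, wk)] stands for the sum of the vi (x) wi.
   Two such sums are equal in the tensor product iff every bilinear map takes
   the same value on them. *)
Definition tensor_eq (s t : seq (V * W)) : bool :=
  `[< forall (U : lmodType K) (f : V -> W -> U), is_bilinear f ->
        \sum_(p <- s) f p.1 p.2 = \sum_(p <- t) f p.1 p.2 >].

Lemma tensor_eq_refl : reflexive tensor_eq.
Proof. by move=> s; apply/asboolP. Qed.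

Lemma tensor_eq_sym : symmetric tensor_eq.
Proof.
by move=> s t; apply/asboolP/asboolP => h U f bf; rewrite (h U f bf).
Qed.

Lemma tensor_eq_trans : transitive tensor_eq.
Proof.
move=> t s u /asboolP h1 /asboolP h2; apply/asboolP => U f bf.
by rewrite (h1 U f bf) (h2 U f bf).
Qed.

Canonical tensor_equiv :=
  EquivRel tensor_eq tensor_eq_refl tensor_eq_sym tensor_eq_trans.

Definition tensor := {eq_quot tensor_equiv}.
HB.instance Definition _ := Choice.on tensor.
HB.instance Definition _ := EqQuotient.on tensor.

Definition tclass (s : seq (V * W)) : tensor := \pi_tensor s.

Lemma tclassP s t :
  (forall (U : lmodType K) (f : V -> W -> U), is_bilinear f ->
     \sum_(p <- s) f p.1 p.2 = \sum_(p <- t) f p.1 p.2) <->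
  tclass s = tclass t.
Proof.
split=> [h|/eqmodP /= /asboolP //].
by apply/eqmodP; rewrite /=; apply/asboolP.
Qed.

Lemma tclassK (x : tensor) : tclass (repr x) = x.
Proof. exact: reprK. Qed.

Lemma tclass_repr s (U : lmodType K) (f : V -> W -> U) : is_bilinear f ->
  \sum_(p <- repr (tclass s)) f p.1 p.2 = \sum_(p <- s) f p.1 p.2.
Proof. by move: U f; apply/tclassP; rewrite tclassK. Qed.

Definition tadd (x y : tensor) : tensor := tclass (repr x ++ repr y).
Definition tscale (c : K) (x : tensor) : tensor :=
  tclass [seq (c *: p.1, p.2) | p <- repr x].
Definition tzero : tensor := tclass [::].
Definition topp (x : tensor) : tensor := tscale (-1) x.

Lemma tensorP (x y : tensor) :
  (forall (U : lmodType K) (f : V -> W -> U), is_bilinear f ->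
     \sum_(p <- repr x) f p.1 p.2 = \sum_(p <- repr y) f p.1 p.2) -> x = y.
Proof. by move/tclassP; rewrite !tclassK. Qed.

Section Eval.
Variables (U : lmodType K) (f : V -> W -> U).
Hypothesis bf : is_bilinear f.
Local Notation ev x := (\sum_(p <- repr x) f p.1 p.2).

Lemma tadd_ev x y : ev (tadd x y) = ev x + ev y.
Proof. by rewrite tclass_repr // big_cat. Qed.

Lemma tzero_ev : ev tzero = 0.
Proof. by rewrite tclass_repr // big_nil. Qed.

Lemma tscale_ev c x : ev (tscale c x) = c *: ev x.
Proof.
rewrite tclass_repr // big_map scaler_sumr /=.
by apply: eq_bigr => p _; rewrite (linPZ (bf.1 p.2)).
Qed.

Lemma topp_ev x : ev (topp x) = - ev x.
Proof. by rewrite tscale_ev scaleN1r. Qed.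
End Eval.

Let tevE := (tadd_ev, tzero_ev, topp_ev, tscale_ev).

Lemma taddA : associative tadd.
Proof. by move=> x y z; apply: tensorP => U f bf; rewrite !tevE // addrA. Qed.
Lemma taddC : commutative tadd.
Proof. by move=> x y; apply: tensorP => U f bf; rewrite !tevE // addrC. Qed.
Lemma tadd0 : left_id tzero tadd.
Proof. by move=> x; apply: tensorP => U f bf; rewrite !tevE // add0r. Qed.
Lemma taddN : left_inverse tzero topp tadd.
Proof. by move=> x; apply: tensorP => U f bf; rewrite !tevE // addNr. Qed.

HB.instance Definition _ :=
  GRing.isZmodule.Build tensor taddA taddC tadd0 taddN.

Lemma tscaleA a b x : tscale a (tscale b x) = tscale (a * b) x.
Proof. by apply: tensorP => U f bf; rewrite !tevE // scalerA. Qed.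
Lemma tscale1 : left_id 1 tscale.
Proof. by move=> x; apply: tensorP => U f bf; rewrite !tevE // scale1r. Qed.
Lemma tscaleDr : right_distributive tscale +%R.
Proof.
by move=> c x y; apply: tensorP => U f bf; rewrite !tevE // scalerDr.
Qed.
Lemma tscaleDl x : {morph tscale^~ x : a b / a + b}.
Proof. by move=> a b; apply: tensorP => U f bf; rewrite !tevE // scalerDl. Qed.

HB.instance Definition _ :=
  GRing.Zmodule_isLmodule.Build K tensor tscaleA tscale1 tscaleDr tscaleDl.

Definition tens (v : V) (w : W) : tensor := tclass [:: (v, w)].

Lemma tens_bilinear : is_bilinear tens.
Proof.
split=> [w c v1 v2|v c w1 w2]; apply: tensorP => U f bf;
  rewrite tadd_ev // tscale_ev // !tclass_repr // !big_seq1 /=.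
- by rewrite bf.1.
- by rewrite bf.2.
Qed.

(* The linear map induced by a bilinear map f. *)
Definition tlift (U : lmodType K) (f : V -> W -> U) (x : tensor) : U :=
  \sum_(p <- repr x) f p.1 p.2.

Lemma tlift_linear (U : lmodType K) (f : V -> W -> U) :
  is_bilinear f -> linear (tlift f).
Proof. by move=> bf c x y; rewrite /tlift tadd_ev // tscale_ev. Qed.

Lemma tlift_tens (U : lmodType K) (f : V -> W -> U) v w :
  is_bilinear f -> tlift f (tens v w) = f v w.
Proof. by move=> bf; rewrite /tlift tclass_repr // big_seq1. Qed.

Lemma tensorE (x : tensor) : x = \sum_(p <- repr x) tens p.1 p.2.
Proof.
apply: tensorP => U f bf; rewrite -!/(tlift f _).
rewrite (linP_sum (tlift_linear bf)); apply: eq_bigr => p _.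
by rewrite tlift_tens.
Qed.

Lemma tensor_ext (U : lmodType K) (f g : tensor -> U) :
  linear f -> linear g -> (forall v w, f (tens v w) = g (tens v w)) -> f =1 g.
Proof.
move=> lf lg fg x; rewrite [x]tensorE !linP_sum //.
by apply: eq_bigr => p _.
Qed.
End Tensor.

Arguments tens {K V W}.

Section TensorMap.
Variables (K : fieldType) (V W V' W' : lmodType K).

(* f (x) g, for linear f and g *)
Definition tmap (f : V -> V') (g : W -> W') : tensor V W -> tensor V' W' :=
  tlift (fun v w => tens (f v) (g w)).

Section Facts.
Variables (f : V -> V') (g : W -> W').
Hypotheses (lf : linear f) (lg : linear g).

Lemma tmap_bilinear : is_bilinear (fun v w => tens (f v) (g w)).
Proof.
split=> [w c v1 v2|v c w1 w2] /=; first by rewrite lf (tens_bilinear _ _).1.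
by rewrite lg (tens_bilinear _ _).2.
Qed.

Lemma tmap_linear : linear (tmap f g).
Proof. exact: tlift_linear tmap_bilinear. Qed.

Lemma tmap_tens v w : tmap f g (tens v w) = tens (f v) (g w).
Proof. exact: tlift_tens tmap_bilinear. Qed.
End Facts.
End TensorMap.

Section TensorProduct.
Variables (K : fieldType) (V1 W1 V2 W2 V W : lmodType K).

(* (v1 (x) w1) (v2 (x) w2) = m v1 v2 (x) m' w1 w2, for bilinear m and m' *)
Definition tprod (m : V1 -> V2 -> V) (m' : W1 -> W2 -> W)
    (x : tensor V1 W1) (y : tensor V2 W2) : tensor V W :=
  tlift (fun v1 w1 => tmap (m v1) (m' w1) y) x.

Section Facts.
Variables (m : V1 -> V2 -> V) (m' : W1 -> W2 -> W).
Hypotheses (bm : is_bilinear m) (bm' : is_bilinear m').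

Lemma tprod_bilinear_aux y :
  is_bilinear (fun v1 w1 => tmap (m v1) (m' w1) y).
Proof.
split=> [w1 c v v'|v1 c w w'] /=.
- rewrite [y]tensorE !(linP_sum (tmap_linear _ _)) //;
    try exact: bm.2; try exact: bm'.2.
  rewrite scaler_sumr -big_split; apply: eq_bigr => p _ /=.
  rewrite !tmap_tens; try exact: bm.2; try exact: bm'.2.
  by rewrite (bm.1 p.1) (tens_bilinear _ _).1.
- rewrite [y]tensorE !(linP_sum (tmap_linear _ _)) //;
    try exact: bm.2; try exact: bm'.2.
  rewrite scaler_sumr -big_split; apply: eq_bigr => p _ /=.
  rewrite !tmap_tens; try exact: bm.2; try exact: bm'.2.
  by rewrite (bm'.1 p.2) (tens_bilinear _ _).2.
Qed.

Lemma tprod_bilinear : is_bilinear (tprod m m').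
Proof.
split=> [y|x c y y'].
  exact: (tlift_linear (tprod_bilinear_aux y)).
rewrite /tprod /tlift scaler_sumr -big_split; apply: eq_bigr => p _ /=.
by rewrite (tmap_linear (bm.2 _) (bm'.2 _)).
Qed.

Lemma tprod_tens v1 w1 v2 w2 :
  tprod m m' (tens v1 w1) (tens v2 w2) = tens (m v1 v2) (m' w1 w2).
Proof.
rewrite /tprod tlift_tens; last exact: tprod_bilinear_aux.
by rewrite tmap_tens //; [exact: bm.2 | exact: bm'.2].
Qed.
End Facts.
End TensorProduct.

Lemma mul_bilinear (K : fieldType) (A : algType K) :
  is_bilinear (fun a b : A => a * b).
Proof.
split=> [b c a a'|a c b b'] /=; first by rewrite mulrDl scalerAl.
by rewrite mulrDr scalerAr.
Qed.

Record hopf_algebra (K : fieldType) (A : algType K) := HopfAlgebra {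
  comult :> A -> tensor A A;
  counit : A -> K;
  antipode : A -> A;
  comult_linear : linear comult;
  counit_linear : linear (counit : A -> K^o);
  antipode_linear : linear antipode;
  comult1 : comult 1 = tens 1 1;
  comultM : forall a b, comult (a * b) =
    tprod (fun x y => x * y) (fun x y => x * y) (comult a) (comult b);
  counit1 : counit 1 = 1;
  counitM : {morph counit : a b / a * b};
  comultA : forall a, tmap idfun comult (comult a) =
    tlift (fun x c => tlift (fun a b => tens a (tens b c)) x)
          (tmap comult idfun (comult a));
  counitl : forall a, tlift (fun x y => counit x *: y) (comult a) = a;
  counitr : forall a, tlift (fun x y => counit y *: x) (comult a) = a;
  antipodel : forall a,
    tlift (fun x y => antipode x * y) (comult a) = (counit a)%:A;
  antipoder : forall a,
    tlift (fun x y => x * antipode y) (comult a) = (counit a)%:A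
}.

Record calculus (K : fieldType) (A : algType K) := Calculus {
  form :> lmodType K;
  lact : A -> form -> form;
  ract : form -> A -> form;
  diff : A -> form
}.

Arguments lact {K A} c a w.
Arguments ract {K A} c w a.
Arguments diff {K A} c a.

Section Covariance.
Variables (K : fieldType) (A : algType K) (H : hopf_algebra A).
Variable Omega : calculus A.

Record is_bimodule : Prop := IsBimodule {
  lact_bilinear : is_bilinear (lact Omega);
  ract_bilinear : is_bilinear (ract Omega);
  lact1 : forall w, lact Omega 1 w = w;
  lactM : forall a b w, lact Omega (a * b) w = lact Omega a (lact Omega b w);
  ract1 : forall w, ract Omega w 1 = w;
  ractM : forall a b w, ract Omega w (a * b) = ract Omega (ract Omega w a) b;
  lractA : forall a b w,
    ract Omega (lact Omega a w) b = lact Omega a (ract Omega w b)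
}.

(* A finite family (a_k, b_k)_k is a list of pairs. *)
Definition form_of (s : seq (A * A)) : Omega :=
  \sum_(p <- s) lact Omega p.1 (diff Omega p.2).

Record is_differential_calculus : Prop := IsDifferentialCalculus {
  calculus_bimodule : is_bimodule;
  diff_linear : linear (diff Omega);
  diffM : forall a b, diff Omega (a * b) =
    lact Omega a (diff Omega b) + ract Omega (diff Omega a) b;
  diff_generates : forall w, exists s, w = form_of s
}.

(* \sum_k Delta(a_k) (id (x) d) Delta(b_k) *)
Definition left_sum (s : seq (A * A)) : tensor A Omega :=
  \sum_(p <- s) tprod (fun x y => x * y) (lact Omega)
    (H p.1) (tmap idfun (diff Omega) (H p.2)).

(* \sum_k Delta(a_k) (d (x) id) Delta(b_k) *)
Definition right_sum (s : seq (A * A)) : tensor Omega A :=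
  \sum_(p <- s) tprod (lact Omega) (fun x y => x * y)
    (H p.1) (tmap (diff Omega) idfun (H p.2)).

Definition left_covariant : Prop :=
  forall s, form_of s = 0 -> left_sum s = 0.

Definition right_covariant : Prop :=
  forall s, form_of s = 0 -> right_sum s = 0.

Definition bicovariant : Prop := left_covariant /\ right_covariant.

(* A family representing w; the empty one if w is not of the form
   \sum_k a_k d(b_k). *)
Definition family_of (w : Omega) : seq (A * A) :=
  xget [::] [set s | form_of s = w]%classic.

(* The coactions \sum_k a_k d(b_k) |-> \sum_k Delta(a_k) (id (x) d) Delta(b_k)
   and \sum_k a_k d(b_k) |-> \sum_k Delta(a_k) (d (x) id) Delta(b_k). They do
   not depend on the choice of the family when the calculus is covariant, see
   left_coactionE and right_coactionE. *)
Definition left_coaction (w : Omega) : tensor A Omega := left_sum (family_of w).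
Definition right_coaction (w : Omega) : tensor Omega A :=
  right_sum (family_of w).

Definition left_invariant (w : Omega) : Prop := left_coaction w = tens 1 w.
Definition right_invariant (w : Omega) : Prop := right_coaction w = tens w 1.

Section CoactionE.
Hypothesis calcO : is_differential_calculus.

Let opp_family (s : seq (A * A)) := [seq (- p.1, p.2) | p <- s].

Lemma form_of_opp s t : form_of (s ++ opp_family t) = form_of s - form_of t.
Proof.
rewrite /form_of big_cat big_map -sumrN; congr (_ + _).
apply: eq_bigr => p _ /=.
by rewrite (linPN ((lact_bilinear (calculus_bimodule calcO)).1 _)).
Qed.

Lemma left_sum_opp s t : left_sum (s ++ opp_family t) = left_sum s - left_sum t.
Proof.
rewrite /left_sum big_cat big_map -sumrN; congr (_ + _).
apply: eq_bigr => p _ /=; rewrite (linPN (comult_linear H)).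
have bt := tprod_bilinear (mul_bilinear A)
  (lact_bilinear (calculus_bimodule calcO)).
by rewrite (linPN (bt.1 _)).
Qed.

Lemma right_sum_opp s t :
  right_sum (s ++ opp_family t) = right_sum s - right_sum t.
Proof.
rewrite /right_sum big_cat big_map -sumrN; congr (_ + _).
apply: eq_bigr => p _ /=; rewrite (linPN (comult_linear H)).
have bt := tprod_bilinear (lact_bilinear (calculus_bimodule calcO))
  (mul_bilinear A).
by rewrite (linPN (bt.1 _)).
Qed.

Lemma family_ofK s : form_of (family_of (form_of s)) = form_of s.
Proof.
exact: (@xgetPex _ [::] [set t | form_of t = form_of s]%classic
  (ex_intro _ s erefl)).
Qed.

Lemma left_coactionE s : left_covariant ->
  left_coaction (form_of s) = left_sum s.
Proof.
move=> cov; apply/eqP; rewrite -subr_eq0 -left_sum_opp; apply/eqP/cov.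
by rewrite form_of_opp family_ofK subrr.
Qed.

Lemma right_coactionE s : right_covariant ->
  right_coaction (form_of s) = right_sum s.
Proof.
move=> cov; apply/eqP; rewrite -subr_eq0 -right_sum_opp; apply/eqP/cov.
by rewrite form_of_opp family_ofK subrr.
Qed.
End CoactionE.
End Covariance.

Section FreeGroup.
Variable n : nat.

(* (i, true) is the generator of index i and (i, false) its inverse. *)
Definition letter := ('I_n * bool)%type.
Definition linv (x : letter) : letter := (x.1, ~~ x.2).
Definition compatible (x y : letter) : bool := y != linv x.
Definition reduced (w : seq letter) : bool := sorted compatible w.

Record reduced_word := ReducedWord { word : seq letter; wordP : reduced word }.

HB.instance Definition _ := [isSub for word].
HB.instance Definition _ := [Choice of reduced_word by <:].

Definition push (x : letter) (w : seq letter) : seq letter :=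
  if w is y :: w' then if y == linv x then w' else x :: w else [:: x].

Lemma linvK : involutive linv.
Proof. by case=> i b; rewrite /linv /= negbK. Qed.

Arguments linv : simpl never.

Lemma push_reduced x w : reduced w -> reduced (push x w).
Proof.
case: w => [//|y w] /= rw; case: eqVneq => [_|xy] /=.
  exact: path_sorted rw.
by rewrite /compatible xy.
Qed.

Lemma push_cons x w : reduced (x :: w) -> push x w = x :: w.
Proof. by case: w => [//|y w] /= /andP[/negPf ->]. Qed.

Lemma pushK x w : reduced w -> push x (push (linv x) w) = w.
Proof.
case: w => [|y w] /= rw; first by rewrite eqxx.
rewrite linvK; case: (eqVneq y x) => [yx|xy] /=; last by rewrite eqxx.
by rewrite -yx push_cons.
Qed.

Definition cat_reduce (u v : seq letter) : seq letter := foldr push v u.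

Lemma cat_reduce_reduced u v : reduced v -> reduced (cat_reduce u v).
Proof. by move=> rv; elim: u => //= x u; apply: push_reduced. Qed.

Lemma cat_reduce_push x u v : reduced v ->
  cat_reduce (push x u) v = push x (cat_reduce u v).
Proof.
move=> rv; case: u => [//|y u] /=; case: eqVneq => [->|//].
by rewrite pushK // cat_reduce_reduced.
Qed.

Lemma cat_reduceA u v w : reduced w ->
  cat_reduce u (cat_reduce v w) = cat_reduce (cat_reduce u v) w.
Proof. by move=> rw; elim: u => //= x u ->; rewrite cat_reduce_push. Qed.

Lemma cat_reduce0 u : reduced u -> cat_reduce u [::] = u.
Proof.
elim: u => //= x u IH rxu; rewrite IH ?push_cons //.
exact: path_sorted rxu.
Qed.

Definition word_inv (u : seq letter) : seq letter := rev (map linv u).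

Lemma word_inv_reduced u : reduced u -> reduced (word_inv u).
Proof.
rewrite /reduced /word_inv rev_sorted sorted_map.
apply: sub_sorted => x y; rewrite /compatible /relpre /= linvK => xy.
by apply: contra_neq xy => ->.
Qed.

Lemma word_invK : involutive word_inv.
Proof. by move=> u; rewrite /word_inv -map_rev revK mapK //; exact: linvK. Qed.

Lemma cat_reduceV u : reduced u -> cat_reduce (word_inv u) u = [::].
Proof.
elim: u => //= x u IH rxu; have ru : reduced u := path_sorted rxu.
rewrite /cat_reduce /word_inv /= rev_cons foldr_rcons -(push_cons rxu).
by rewrite -{2}[x]linvK pushK // -/(word_inv u) -/(cat_reduce _ _) IH.
Qed.

Definition free_one : reduced_word := @ReducedWord [::] isT.
Definition free_inv (u : reduced_word) : reduced_word :=
  ReducedWord (word_inv_reduced (wordP u)).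
Definition free_mul (u v : reduced_word) : reduced_word :=
  ReducedWord (cat_reduce_reduced (word u) (wordP v)).

Lemma free_mulA : associative free_mul.
Proof. by move=> u v w; apply: val_inj; rewrite /= cat_reduceA // wordP. Qed.
Lemma free_mul1 : left_id free_one free_mul.
Proof. by move=> u; apply: val_inj. Qed.
Lemma free_mulr1 : right_id free_one free_mul.
Proof. by move=> u; apply: val_inj; rewrite /= cat_reduce0 // wordP. Qed.
Lemma free_mulV : left_inverse free_one free_inv free_mul.
Proof. by move=> u; apply: val_inj; rewrite /= cat_reduceV // wordP. Qed.
Lemma free_mulrV : right_inverse free_one free_inv free_mul.
Proof.
move=> u; apply: val_inj; rewrite /= -{1}(word_invK (word u)).
by rewrite cat_reduceV // word_inv_reduced // wordP.
Qed.

HB.instance Definition _ :=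
  isGroup.Build reduced_word free_mulA free_mul1 free_mulr1 free_mulV free_mulrV.

Definition free_group : groupType := reduced_word.

Definition free_gen (i : 'I_n) : free_group := @ReducedWord [:: (i, true)] isT.

(* The sum of the exponents of the i-th generator in g. *)
Definition exponent (i : 'I_n) (g : free_group) : int :=
  \sum_(x <- word g | x.1 == i) (if x.2 then 1 else -1).

Lemma exponentM i g h : exponent i (g * h)%g = exponent i g + exponent i h.
Proof.
case: g h => [u ru] [v rv]; rewrite /exponent /= {ru}.
have pushE x w : \sum_(y <- push x w | y.1 == i) (if y.2 then 1 else -1) =
    (if x.1 == i then if x.2 then 1 else -1 else 0) +
    \sum_(y <- w | y.1 == i) (if y.2 then 1 else -1) :> int.
  case: w => [|y w] /=; first by rewrite big_cons; case: eqP; rewrite ?add0r.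
  case: eqVneq => [->|_]; rewrite !big_cons /=.
    by case: eqP; case: (x.2); rewrite ?add0r // addrA ?subrr ?addNr add0r.
  by case: eqP; case: eqP; rewrite ?add0r.
elim: u => [|x u IH] /=; first by rewrite big_nil add0r.
by rewrite pushE IH big_cons; case: eqP; rewrite ?add0r ?addrA.
Qed.

Lemma exponent_gen i j : exponent i (free_gen j) = (i == j)%:R.
Proof.
by rewrite /exponent /= big_cons big_nil /= eq_sym; case: eqP; rewrite ?addr0.
Qed.

Lemma exponent_genV i j : exponent i (free_gen j)^-1%g = - (i == j)%:R.
Proof.
rewrite /exponent /= /word_inv /= big_cons big_nil /= eq_sym.
by case: eqP; rewrite ?addr0 ?oppr0.
Qed.
End FreeGroup.

Section GroupAlgebra.
Variables (K : fieldType) (G : groupType).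

Definition group_algebra := {malg K[G]}.
HB.instance Definition _ := Choice.on group_algebra.

(* The operations are those of {malg K[G]}. They are locked, like delta below,
   because a failing comparison of unlocked ones by conversion does not end in
   practice. *)
Fact ga_key : unit. Proof. exact: tt. Qed.
Definition ga_zero : group_algebra := locked_with ga_key (0 : {malg K[G]}).
Definition ga_opp : group_algebra -> group_algebra :=
  locked_with ga_key (fun a : {malg K[G]} => - a).
Definition ga_add : group_algebra -> group_algebra -> group_algebra :=
  locked_with ga_key (fun a b : {malg K[G]} => a + b).
Definition ga_scale : K -> group_algebra -> group_algebra :=
  locked_with ga_key (fun c (a : {malg K[G]}) => c *: a).

Let gaE : (ga_zero = (0 : {malg K[G]})) *
  (forall a, ga_opp a = - (a : {malg K[G]})) *
  (forall a b, ga_add a b = (a : {malg K[G]}) + b) *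
  (forall c a, ga_scale c a = c *: (a : {malg K[G]})).
Proof. by rewrite /ga_zero /ga_opp /ga_add /ga_scale !unlock. Qed.

Lemma ga_addA : associative ga_add.
Proof. by move=> a b c; rewrite !gaE addrA. Qed.
Lemma ga_addC : commutative ga_add.
Proof. by move=> a b; rewrite !gaE addrC. Qed.
Lemma ga_add0 : left_id ga_zero ga_add.
Proof. by move=> a; rewrite !gaE add0r. Qed.
Lemma ga_addN : left_inverse ga_zero ga_opp ga_add.
Proof. by move=> a; rewrite !gaE addNr. Qed.

Lemma ga_scaleA a b x : ga_scale a (ga_scale b x) = ga_scale (a * b) x.
Proof. by rewrite !gaE scalerA. Qed.
Lemma ga_scale1 : left_id 1 ga_scale.
Proof. by move=> x; rewrite !gaE scale1r. Qed.
Lemma ga_scaleDr : right_distributive ga_scale ga_add.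
Proof. by move=> c x y; rewrite !gaE scalerDr. Qed.
Lemma ga_scaleDl x : {morph ga_scale^~ x : a b / a + b >-> ga_add a b}.
Proof. by move=> a b; rewrite !gaE scalerDl. Qed.

HB.instance Definition _ :=
  GRing.isZmodule.Build group_algebra ga_addA ga_addC ga_add0 ga_addN.

HB.instance Definition _ := GRing.Zmodule_isLmodule.Build K group_algebra
  ga_scaleA ga_scale1 ga_scaleDr ga_scaleDl.

Definition delta : G -> group_algebra := locked_with ga_key (fun g => << g >>).

Definition coef (g : G) (a : group_algebra) : K := a@_g.

Lemma coef_delta g h : coef h (delta g) = (g == h)%:R.
Proof. by rewrite /coef /delta unlock mcoeffU. Qed.

Lemma coefD g a b : coef g (a + b) = coef g a + coef g b.
Proof. by rewrite /coef [X in mcoeff g X](gaE.1.2 a b) mcoeffD. Qed.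

Lemma coefZ g c a : coef g (c *: a) = c * coef g a.
Proof. by rewrite /coef [X in mcoeff g X](gaE.2 c a) mcoeffZ. Qed.

Lemma coef_linear g : linear (coef g : group_algebra -> K^o).
Proof. by move=> c a b; rewrite coefD coefZ. Qed.

Lemma coef0 g : coef g 0 = 0.
Proof. exact: (linP0 (coef_linear g)). Qed.

Lemma coefP a b : (forall g, coef g a = coef g b) -> a = b.
Proof. by move=> ab; apply/malgP. Qed.

(* The linear map sending delta g to phi g. *)
Definition glin (V : lmodType K) (phi : G -> V) (a : group_algebra) : V :=
  \sum_(g <- msupp a) coef g a *: phi g.

Lemma glinw (V : lmodType K) (phi : G -> V) a (D : {fset G}) :
  (msupp a `<=` D)%fset -> glin phi a = \sum_(g <- D) coef g a *: phi g.
Proof.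
move=> sD; rewrite /glin (big_fset_incl _ sD) //= => g _ ga.
by rewrite /coef mcoeff_outdom // scale0r.
Qed.

Lemma glin_linear (V : lmodType K) (phi : G -> V) : linear (glin phi).
Proof.
move=> c a b; pose D := (msupp (c *: a + b) `|` (msupp a `|` msupp b))%fset.
rewrite (@glinw _ _ _ D) ?fsubsetUl // (@glinw _ _ a D); last first.
  by rewrite /D fsetUCA fsubsetUl.
rewrite (@glinw _ _ b D); last by rewrite /D fsetUA fsubsetUr.
rewrite scaler_sumr -big_split; apply: eq_bigr => g _ /=.
by rewrite coefD coefZ scalerDl scalerA.
Qed.

Lemma glin_delta (V : lmodType K) (phi : G -> V) g : glin phi (delta g) = phi g.
Proof.
rewrite (@glinw _ _ _ [fset g]%fset); last by rewrite /delta unlock msuppU_le.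
by rewrite big_seq_fset1 coef_delta eqxx scale1r.
Qed.

Lemma deltaE (a : group_algebra) : a = glin delta a.
Proof.
apply: coefP => h; rewrite /glin (linP_sum (coef_linear h)).
under eq_bigr do rewrite (linPZ (coef_linear h)) coef_delta.
have [ha|ha] := boolP (h \in msupp a).
  rewrite (big_fsetD1 h) //= eqxx [_ *: 1]mulr1 big1_fset ?addr0 // => g.
  by rewrite !inE => /andP[/negPf -> _] _; rewrite scaler0.
rewrite /coef mcoeff_outdom // big1_fset // => g ga _.
by case: eqP ga ha => [-> ->|_]; rewrite ?scaler0.
Qed.

Lemma glin_ext (V : lmodType K) (f h : group_algebra -> V) :
  linear f -> linear h -> (forall g, f (delta g) = h (delta g)) -> f =1 h.
Proof.
move=> lf lh fh a; rewrite [a]deltaE !linP_sum //.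
by apply: eq_bigr => g _; rewrite !linPZ // fh.
Qed.

Definition gmul : group_algebra -> group_algebra -> group_algebra :=
  locked_with ga_key
    (fun a b => glin (fun g => glin (fun h => delta (g * h)%g) b) a).

Lemma gmulE a b :
  gmul a b = glin (fun g => glin (fun h => delta (g * h)%g) b) a.
Proof. by rewrite /gmul unlock. Qed.

Lemma gmul_bilinear : is_bilinear gmul.
Proof.
split=> [b c a a'|a c b b'] /=; rewrite !gmulE; first exact: glin_linear.
rewrite {1 3 5}/glin scaler_sumr -big_split; apply: eq_bigr => g _ /=.
by rewrite glin_linear scalerDr !scalerA mulrC.
Qed.

Lemma gmul_delta g h : gmul (delta g) (delta h) = delta (g * h)%g.
Proof. by rewrite gmulE !glin_delta. Qed.

Let lml b : linear (gmul^~ b) := gmul_bilinear.1 b.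
Let lmr a : linear (gmul a) := gmul_bilinear.2 a.

Lemma gmulA : associative gmul.
Proof.
move=> a b c; apply: (glin_ext (f := fun a => gmul a (gmul b c))
  (h := fun a => gmul (gmul a b) c)) => [k u v|k u v|g] /=.
- by rewrite (lml _).
- by rewrite !(lml _).
apply: (glin_ext (f := fun b => gmul (delta g) (gmul b c))
  (h := fun b => gmul (gmul (delta g) b) c)) => [k u v|k u v|h] /=.
- by rewrite (lml _) (lmr _).
- by rewrite (lmr _) (lml _).
apply: (glin_ext (f := fun c => gmul (delta g) (gmul (delta h) c))
  (h := fun c => gmul (gmul (delta g) (delta h)) c)) => [k u v|//|j] /=.
- by rewrite !(lmr _).
by rewrite !gmul_delta mulgA.
Qed.

Lemma gmul1 : left_id (delta 1%g) gmul.
Proof.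
by apply: glin_ext => [//|//|g] /=; rewrite gmul_delta mul1g.
Qed.

Lemma gmulr1 : right_id (delta 1%g) gmul.
Proof.
by apply: glin_ext => [//|//|g] /=; rewrite gmul_delta mulg1.
Qed.

Lemma gmulDl : left_distributive gmul +%R.
Proof. by move=> a b c; rewrite (linPD (lml c)). Qed.

Lemma gmulDr : right_distributive gmul +%R.
Proof. by move=> a b c; rewrite (linPD (lmr a)). Qed.

Lemma delta1_neq0 : delta 1%g != 0.
Proof.
apply/eqP => /(congr1 (coef 1%g)) /eqP.
by rewrite coef_delta (linP0 (coef_linear _)) eqxx oner_eq0.
Qed.

HB.instance Definition _ := GRing.Zmodule_isNzRing.Build group_algebra
  gmulA gmul1 gmulr1 gmulDl gmulDr delta1_neq0.

Lemma gscalerAl c (a b : group_algebra) : c *: (a * b) = (c *: a) * b.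
Proof. by rewrite [RHS](linPZ (lml b)). Qed.

HB.instance Definition _ := GRing.Lmodule_isLalgebra.Build K group_algebra
  gscalerAl.

Lemma gscalerAr c (a b : group_algebra) : c *: (a * b) = a * (c *: b).
Proof. by rewrite [RHS](linPZ (lmr a)). Qed.

HB.instance Definition _ := GRing.Lalgebra_isAlgebra.Build K group_algebra
  gscalerAr.

Lemma deltaM g h : delta g * delta h = delta (g * h)%g.
Proof. exact: gmul_delta. Qed.

Lemma delta1 : delta 1%g = 1.
Proof. by []. Qed.
End GroupAlgebra.

Section GroupHopf.
Variables (K : fieldType) (G : groupType).
Local Notation A := (group_algebra K G).

Definition group_comult : A -> tensor A A :=
  glin (fun g => tens (delta K g) (delta K g)).
Definition group_counit : A -> K := glin (V := K^o) (fun=> 1).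
Definition group_antipode : A -> A := glin (fun g => delta K g^-1%g).

Let cm_linear : linear group_comult := glin_linear _.
Let cu_linear : linear (group_counit : A -> K^o) := glin_linear _.
Let ap_linear : linear group_antipode := glin_linear _.

Let cm_delta g : group_comult (delta K g) = tens (delta K g) (delta K g).
Proof. exact: glin_delta. Qed.
Let cu_delta g : group_counit (delta K g) = 1.
Proof. exact: (@glin_delta K G K^o). Qed.
Let ap_delta g : group_antipode (delta K g) = delta K g^-1%g.
Proof. exact: glin_delta. Qed.

Let bmul := mul_bilinear A.
Let btmul := tprod_bilinear bmul bmul.

Lemma group_comultM (a b : A) : group_comult (a * b) =
  tprod (fun x y => x * y) (fun x y => x * y)
    (group_comult a) (group_comult b).
Proof.
apply: (glin_ext (f := fun a => group_comult (a * b))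
  (h := fun a => tprod _ _ (group_comult a) (group_comult b))) a
  => [c u v|c u v|g] /=.
- by rewrite (bmul.1 b) cm_linear.
- by rewrite cm_linear (btmul.1 _).
apply: (glin_ext (f := fun b => group_comult (delta K g * b))
  (h := fun b => tprod _ _ (group_comult (delta K g)) (group_comult b))) b
  => [c u v|c u v|h] /=.
- by rewrite (bmul.2 _) cm_linear.
- by rewrite cm_linear (btmul.2 _).
by rewrite deltaM !cm_delta tprod_tens // deltaM.
Qed.

Lemma group_counitM : {morph group_counit : a b / a * b}.
Proof.
move=> a b.
apply: (glin_ext (V := K^o) (f := fun a => group_counit (a * b))
  (h := fun a => group_counit a * group_counit b)) a => [c u v|c u v|g] /=.
- by rewrite (bmul.1 b) cu_linear.
- by rewrite cu_linear /GRing.scale /= mulrDl mulrA.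
apply: (glin_ext (V := K^o) (f := fun b => group_counit (delta K g * b))
  (h := fun b => group_counit (delta K g) * group_counit b)) b
  => [c u v|c u v|h] /=.
- by rewrite (bmul.2 _) cu_linear.
- by rewrite cu_linear /GRing.scale /= mulrDr mulrCA.
by rewrite deltaM !cu_delta mulr1.
Qed.

Let assoc_bilinear1 (c : A) : is_bilinear (fun a b : A => tens a (tens b c)).
Proof.
split=> [w k u v|w k u v] /=; first by rewrite (tens_bilinear _ _).1.
by rewrite (tens_bilinear _ _).1 (tens_bilinear _ _).2.
Qed.

Let assoc_bilinear : is_bilinear
  (fun (x : tensor A A) (c : A) => tlift (fun a b => tens a (tens b c)) x).
Proof.
split=> [c|x k u v] /=; first exact: tlift_linear (assoc_bilinear1 c).
rewrite /tlift scaler_sumr -big_split; apply: eq_bigr => p _ /=.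
by rewrite !(tens_bilinear _ _).2.
Qed.

Lemma group_comultA (a : A) : tmap idfun group_comult (group_comult a) =
    tlift (fun x c => tlift (fun a b => tens a (tens b c)) x)
          (tmap group_comult idfun (group_comult a)).
Proof.
move: a; apply: glin_ext => [||g].
- exact: lin_comp cm_linear (tmap_linear (@lin_id _ _) cm_linear).
- apply: lin_comp (lin_comp cm_linear (tmap_linear cm_linear (@lin_id _ _))) _.
  exact: tlift_linear assoc_bilinear.
rewrite !cm_delta !tmap_tens // cm_delta tlift_tens //.
by rewrite tlift_tens.
Qed.

Let counitl_bilinear : is_bilinear (fun x y : A => group_counit x *: y).
Proof.
split=> [w k u v|w k u v] /=.
  by rewrite cu_linear scalerDl scalerA.
by rewrite scalerDr !scalerA mulrC.
Qed.

Let counitr_bilinear : is_bilinear (fun x y : A => group_counit y *: x).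
Proof.
split=> [w k u v|w k u v] /=; last by rewrite cu_linear scalerDl scalerA.
by rewrite scalerDr !scalerA mulrC.
Qed.

Let antil_bilinear : is_bilinear (fun x y : A => group_antipode x * y).
Proof.
split=> [w k u v|w k u v] /=; first by rewrite ap_linear (bmul.1 _).
by rewrite (bmul.2 _).
Qed.

Let antir_bilinear : is_bilinear (fun x y : A => x * group_antipode y).
Proof.
split=> [w k u v|w k u v] /=; last by rewrite ap_linear (bmul.2 _).
by rewrite (bmul.1 _).
Qed.

Let unit_linear : linear (fun a : A => (group_counit a)%:A : A).
Proof. by move=> k u v; rewrite cu_linear scalerDl scalerA. Qed.

Lemma group_counitl (a : A) :
  tlift (fun x y => group_counit x *: y) (group_comult a) = a.
Proof.
move: a; apply: glin_ext => [|//|g].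
  exact: lin_comp cm_linear (tlift_linear counitl_bilinear).
rewrite cm_delta tlift_tens; last exact: counitl_bilinear.
by rewrite cu_delta scale1r.
Qed.

Lemma group_counitr (a : A) :
  tlift (fun x y => group_counit y *: x) (group_comult a) = a.
Proof.
move: a; apply: glin_ext => [|//|g].
  exact: lin_comp cm_linear (tlift_linear counitr_bilinear).
rewrite cm_delta tlift_tens; last exact: counitr_bilinear.
by rewrite cu_delta scale1r.
Qed.

Lemma group_antipodel (a : A) :
  tlift (fun x y => group_antipode x * y) (group_comult a) =
  (group_counit a)%:A.
Proof.
move: a; apply: glin_ext => [|//|g].
  exact: lin_comp cm_linear (tlift_linear antil_bilinear).
rewrite cm_delta tlift_tens; last exact: antil_bilinear.
by rewrite cu_delta ap_delta deltaM mulVg delta1 scale1r.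
Qed.

Lemma group_antipoder (a : A) :
  tlift (fun x y => x * group_antipode y) (group_comult a) =
  (group_counit a)%:A.
Proof.
move: a; apply: glin_ext => [|//|g].
  exact: lin_comp cm_linear (tlift_linear antir_bilinear).
rewrite cm_delta tlift_tens; last exact: antir_bilinear.
by rewrite cu_delta ap_delta deltaM mulgV delta1 scale1r.
Qed.

Definition group_hopf : hopf_algebra A :=
  HopfAlgebra cm_linear cu_linear ap_linear (cm_delta 1%g) group_comultM
    (cu_delta 1%g) group_counitM group_comultA group_counitl group_counitr
    group_antipodel group_antipoder.
End GroupHopf.

Section Derivations.
Variables (K : fieldType) (n : nat).
Local Notation A := (group_algebra K (free_group n)).

(* The infinitesimal generator of the torus action: the i-th circle acts on
   delta g with weight the exponent sum of the i-th generator in g. It is the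
   only derivation satisfying partial_gen and partial_genV. *)
Definition partial (i : 'I_n) : A -> A :=
  glin (fun g => (exponent i g)%:~R *: delta K g).

Lemma partial_linear i : linear (partial i).
Proof. exact: glin_linear. Qed.

Lemma partial_delta i g :
  partial i (delta K g) = (exponent i g)%:~R *: delta K g.
Proof. exact: glin_delta. Qed.

Lemma partialM i (a b : A) :
  partial i (a * b) = partial i a * b + a * partial i b.
Proof.
have bmul := mul_bilinear A; have lp := partial_linear i.
apply: (glin_ext (f := fun a => partial i (a * b))
  (h := fun a => partial i a * b + a * partial i b)) a => [c u v|c u v|g] /=.
- by rewrite (bmul.1 _) lp.
- by rewrite lp !(bmul.1 _) scalerDr addrACA.
apply: (glin_ext (f := fun b => partial i (delta K g * b))
  (h := fun b => partial i (delta K g) * b + delta K g * partial i b)) b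
  => [c u v|c u v|h] /=.
- by rewrite (bmul.2 _) lp.
- by rewrite lp !(bmul.2 _) scalerDr addrACA.
rewrite deltaM !partial_delta exponentM -scalerAl -scalerAr deltaM.
by rewrite -scalerDl rmorphD.
Qed.

Lemma partial_gen i j :
  partial i (delta K (free_gen j)) = (i == j)%:R *: delta K (free_gen i).
Proof.
rewrite partial_delta exponent_gen mulrz_nat.
by case: (eqVneq i j) => [->|_]; [|rewrite !scale0r].
Qed.

Lemma partial_genV i j :
  partial i (delta K (free_gen j)^-1%g) =
  - ((i == j)%:R *: delta K (free_gen j)^-1%g).
Proof. by rewrite partial_delta exponent_genV mulrNz mulrz_nat scaleNr. Qed.
End Derivations.

Section CanonicalCalculus.
Variables (K : fieldType) (n N : nat) (gamma : 'I_n -> 'M[K]_N).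
Local Notation A := (group_algebra K (free_group n)).

(* For K the field of complex numbers and every faithful state tau_0,
   A (x) K^N is dense in the Hilbert space L^2(C^*_r(F_n), tau_0) (x) K^N and
   stable under the Dirac operator and the pi_op a. The one-forms are bounded
   operators, hence determined by their restrictions to A (x) K^N, on which
   tau_0 has no influence; they are represented by these restrictions. *)
Local Notation core := (tensor A 'cV[K]_N).

Definition simple_op (f : A -> A) (m : 'M[K]_N) : core -> core :=
  tmap f (fun v => m *m v).

Definition pi_op (a : A) : core -> core := simple_op (fun b => a * b) 1%:M.

Definition dirac : core -> core :=
  \sum_(i < n) simple_op (partial i) (gamma i).

Definition dirac_comm (a : A) : core -> core :=
  fun x => dirac (pi_op a x) - pi_op a (dirac x).

Definition basis_op (i : 'I_n) : core -> core := simple_op idfun (gamma i).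

Let lmulm (m : 'M[K]_N) : linear (fun v : 'cV[K]_N => m *m v).
Proof. by move=> c u v; rewrite mulmxDr scalemxAr. Qed.

Let lmull (a : A) : linear (fun b : A => a * b).
Proof. exact: (mul_bilinear A).2. Qed.

Lemma simple_op_linear f m : linear f -> linear (simple_op f m).
Proof. by move=> lf; apply: tmap_linear. Qed.

Lemma simple_op_tens f m b v :
  linear f -> simple_op f m (tens b v) = tens (f b) (m *m v).
Proof. by move=> lf; apply: tmap_tens. Qed.

Lemma pi_op_tens a b v : pi_op a (tens b v) = tens (a * b) v.
Proof. by rewrite /pi_op simple_op_tens // mul1mx. Qed.

Lemma pi_op_linear a : linear (pi_op a).
Proof. exact: simple_op_linear. Qed.

Lemma dirac_linear : linear dirac.
Proof.
move=> c u v; rewrite /dirac !fct_sumE scaler_sumr -big_split /=.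
by apply: eq_bigr => i _; rewrite simple_op_linear //; apply: partial_linear.
Qed.

Lemma pi_op1 : pi_op 1 = idfun.
Proof.
apply/funext; apply: tensor_ext => [||b v] //; first exact: pi_op_linear.
by rewrite pi_op_tens mul1r.
Qed.

Lemma pi_opM a b : pi_op (a * b) = pi_op a \o pi_op b.
Proof.
apply/funext; apply: tensor_ext => [||c v] /=; first exact: pi_op_linear.
  exact: lin_comp (pi_op_linear b) (pi_op_linear a).
by rewrite !pi_op_tens mulrA.
Qed.

Lemma pi_op_actl c a b x : pi_op (c *: a + b) x = c *: pi_op a x + pi_op b x.
Proof.
apply: (tensor_ext (f := pi_op (c *: a + b))
  (g := fun x => c *: pi_op a x + pi_op b x)) x => [|k u v|d v] /=.
- exact: pi_op_linear.
- by rewrite !pi_op_linear !scalerDr !scalerA [k * c]mulrC addrACA.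
rewrite !pi_op_tens ((mul_bilinear A).1 d).
by rewrite (tens_bilinear _ _).1.
Qed.

Lemma dirac_commE a : dirac_comm a =
  \sum_(i < n) simple_op (fun b => partial i a * b) (gamma i).
Proof.
have lp i := @partial_linear K n i.
apply/funext; apply: tensor_ext => [c u v|c u v|b v].
- rewrite /dirac_comm pi_op_linear !dirac_linear pi_op_linear scalerBr.
  by rewrite opprD addrACA.
- rewrite !fct_sumE scaler_sumr -big_split; apply: eq_bigr => i _ /=.
  by rewrite simple_op_linear.
rewrite /dirac_comm pi_op_tens /dirac !fct_sumE.
rewrite (linP_sum (pi_op_linear a)) -sumrB; apply: eq_bigr => i _.
rewrite !simple_op_tens //; try exact: lp.
rewrite pi_op_tens partialM (linPD ((tens_bilinear _ _).1 _)).
by rewrite addrK.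
Qed.

Lemma dirac_commM a b :
  dirac_comm (a * b) = (pi_op a \o dirac_comm b) + (dirac_comm a \o pi_op b).
Proof.
apply/funext => x; rewrite /dirac_comm !pi_opM !fctE /=.
by rewrite (linPB (pi_op_linear a)) addrC addrA subrK.
Qed.

Lemma dirac_comm_linear : linear dirac_comm.
Proof.
move=> c a b; apply/funext => x.
rewrite /dirac_comm !fctE /= !pi_op_actl dirac_linear scalerBr opprD addrACA.
by [].
Qed.

(* The image under Pi of the universal one-forms: the operators
   \sum_k pi_op(a_k) [D, pi_op(b_k)]. In degree one there is nothing to divide
   by: Pi(delta J_0^0) is made of the [D, pi_op a] with pi_op a = 0, and these
   vanish, see junk_form0. *)
Definition is_form (T : core -> core) : bool :=
  `[< exists s : seq (A * A),
        T = \sum_(p <- s) (pi_op p.1 \o dirac_comm p.2) >].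

Lemma junk_form0 a : pi_op a = 0 -> dirac_comm a = 0.
Proof.
move=> a0; apply/funext => x; rewrite /dirac_comm a0 /=.
by rewrite (linP0 dirac_linear) subrr.
Qed.

Lemma is_form_submod : submod_closed is_form.
Proof.
split=> [|c S T /asboolP[s ->] /asboolP[t ->]].
  by apply/asboolP; exists [::]; rewrite big_nil.
apply/asboolP; exists ([seq (c *: p.1, p.2) | p <- s] ++ t).
rewrite big_cat big_map scaler_sumr; congr (_ + _); apply: eq_bigr => p _ /=.
apply/funext => x; rewrite !fctE /=.
have := pi_op_actl c p.1 0 (dirac_comm p.2 x); rewrite addr0 => ->.
suff -> : pi_op 0 = 0 by rewrite addr0.
apply/funext => y; have := pi_op_actl (-1) 0 0 y.
by rewrite scaler0 addr0 scaleN1r addNr.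
Qed.

HB.instance Definition _ :=
  GRing.isSubmodClosed.Build K (core -> core) is_form is_form_submod.

Record one_form := OneForm { oper : core -> core; operP : oper \in is_form }.

HB.instance Definition _ := [isSub for oper].
HB.instance Definition _ := [Choice of one_form by <:].
HB.instance Definition _ := [SubChoice_isSubLmodule of one_form by <:].

Lemma lact_form a (w : one_form) : pi_op a \o oper w \in is_form.
Proof.
have /asboolP[s ->] := operP w; apply/asboolP.
exists [seq (a * p.1, p.2) | p <- s]; rewrite big_map.
apply/funext => x; rewrite /= !fct_sumE (linP_sum (pi_op_linear a)).
by apply: eq_bigr => p _; rewrite pi_opM.
Qed.

Lemma ract_form (w : one_form) a : oper w \o pi_op a \in is_form.
Proof.
have /asboolP[s ->] := operP w; apply/asboolP.
exists (flatten [seq [:: (p.1, p.2 * a); (- (p.1 * p.2), a)] | p <- s]).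
rewrite big_flatten big_map.
apply/funext => x; rewrite /= !fct_sumE; apply: eq_bigr => p _.
rewrite big_cons big_seq1 !fctE /= dirac_commM !fctE /=.
have piN b y : pi_op (- b) y = - pi_op b y.
  have := pi_op_actl (-1) b 0 y; rewrite addr0 !scaleN1r => ->.
  have := pi_op_actl (-1) 0 0 y.
  by rewrite scaler0 addr0 scaleN1r addNr => ->; rewrite addr0.
by rewrite piN pi_opM /= [in RHS](linPD (pi_op_linear _)) [RHS]addrC addKr.
Qed.

Lemma diff_form a : dirac_comm a \in is_form.
Proof.
by apply/asboolP; exists [:: (1, a)]; rewrite big_seq1 pi_op1.
Qed.

Definition canonical_calculus : calculus A :=
  @Calculus K A one_form
    (fun a w => OneForm (lact_form a w))
    (fun w a => OneForm (ract_form w a))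
    (fun a => OneForm (diff_form a)).

Lemma basis_opE i : basis_op i =
  pi_op (delta K (free_gen i)^-1%g) \o dirac_comm (delta K (free_gen i)).
Proof.
apply/funext; apply: tensor_ext => [||b v].
- exact: simple_op_linear.
- rewrite dirac_commE; apply: lin_comp (pi_op_linear _).
  move=> c u v; rewrite !fct_sumE scaler_sumr -big_split.
  by apply: eq_bigr => j _; rewrite simple_op_linear.
rewrite /= dirac_commE fct_sumE (bigD1 i) //= big1 ?addr0 => [|j ji].
  rewrite /basis_op !simple_op_tens // pi_op_tens partial_gen eqxx scale1r.
  by rewrite mulrA deltaM mulVg delta1 mul1r.
rewrite simple_op_tens // partial_gen (negPf ji) scale0r mul0r.
by rewrite (linP0 ((tens_bilinear _ _).1 _)).
Qed.

Lemma basis_form i : basis_op i \in is_form.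
Proof.
apply/asboolP; rewrite basis_opE.
exists [:: (delta K (free_gen i)^-1%g, delta K (free_gen i))].
by rewrite big_seq1.
Qed.

Definition canonical_basis (i : 'I_n) : canonical_calculus :=
  OneForm (basis_form i).

Definition gamma_matrices : Prop :=
  (forall i, gamma i *m gamma i = 1%:M) /\
  (forall i j, i != j -> gamma i *m gamma j = - (gamma j *m gamma i)).
End CanonicalCalculus.

(* Main.v *)
Require Import Defs.
From HB Require Import structures.
From mathcomp Require Import all_boot all_order all_algebra.
From mathcomp Require Import boolp functions.
From mathcomp Require Import reals complex.

Set Implicit Arguments.
Unset Strict Implicit.
Unset Printing Implicit Defensive.

Import GRing.Theory.

Local Open Scope ring_scope.

(* Anticommuting a one-form w = sum_j a_j e_j with e_j recovers 2 a_j, so the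
   components a_j depend linearly on w, and those of a d(b) are a partial_j b.
   On group elements, delta_g d(delta_h) = sum_j exp_j(h) delta_gh e_j has left
   coaction sum_j exp_j(h) delta_gh (x) delta_gh e_j. Hence
   sum_k Delta(a_k) (id (x) d) Delta(b_k) is the sum over j of a linear image of
   the j-th component of sum_k a_k d(b_k), and vanishes with it; the right side
   is symmetric. Invariance of e_j is read off e_j = delta_g^-1 d(delta_g) for
   g the j-th generator. *)

Section FirstOrder.
Variables (K : fieldType) (n N : nat) (gamma : 'I_n -> 'M[K]_N).
Local Notation A := (group_algebra K (free_group n)).
Local Notation Omega := (canonical_calculus gamma).
Local Notation delta := (@delta K (free_group n)).

(** * One-forms as operators, and the axioms of the calculus *)

Lemma oper_inj : injective (@oper K n N gamma).
Proof. exact: val_inj. Qed.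

Lemma operD (u v : Omega) x : oper (u + v) x = oper u x + oper v x.
Proof. by []. Qed.

Lemma operZ c (u : Omega) x : oper (c *: u) x = c *: oper u x.
Proof. by []. Qed.

Lemma oper_sum (I : Type) (r : seq I) (F : I -> Omega) :
  oper (\sum_(i <- r) F i) = \sum_(i <- r) oper (F i).
Proof. exact: (big_morph (@oper K n N gamma)). Qed.

Lemma dirac_comm_op_linear a : linear (dirac_comm gamma a).
Proof.
rewrite dirac_commE => c u v; rewrite !fct_sumE scaler_sumr -big_split.
apply: eq_bigr => i _; rewrite simple_op_linear //.
exact: (mul_bilinear A).2.
Qed.

(** [is_form] does not record linearity; it is inherited from a representing family. The right
    action needs it, since there [w] is applied after [pi_op]. *)
Lemma oper_linear (w : Omega) : linear (oper w).
Proof.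
have /asboolP[s ->] := operP w => c u v.
rewrite !fct_sumE scaler_sumr -big_split; apply: eq_bigr => p _ /=.
by rewrite dirac_comm_op_linear pi_op_linear.
Qed.

Lemma canonical_bimodule : is_bimodule Omega.
Proof.
split.
- split=> [w c a b|a c u v]; apply/oper_inj/funext => x.
    exact: pi_op_actl.
  exact: (pi_op_linear a c (oper u x) (oper v x)).
- split=> [a c u v|w c a b]; first exact: oper_inj.
  apply/oper_inj/funext => x.
  by rewrite operD operZ /= pi_op_actl oper_linear.
- by move=> w; apply/oper_inj/funext => x /=; rewrite pi_op1.
- by move=> a b w; apply/oper_inj/funext => x /=; rewrite pi_opM.
- by move=> w; apply/oper_inj/funext => x /=; rewrite pi_op1.
- by move=> a b w; apply/oper_inj/funext => x /=; rewrite pi_opM.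
- by move=> a b w; apply/oper_inj.
Qed.

Lemma canonical_differential : is_differential_calculus Omega.
Proof.
split; first exact: canonical_bimodule.
- by move=> c a b; apply/oper_inj; rewrite /= dirac_comm_linear.
- by move=> a b; apply/oper_inj; rewrite /= dirac_commM.
- move=> w; have /asboolP[s ws] := operP w.
  by exists s; apply/oper_inj; rewrite oper_sum ws.
Qed.

Let bimod := canonical_bimodule.
Let lactb : is_bilinear (lact Omega) := lact_bilinear bimod.
Let difflin : linear (diff Omega) := diff_linear canonical_differential.
Let mulb := mul_bilinear A.

Lemma basis_op_linear j : linear (basis_op gamma j).
Proof. exact: simple_op_linear. Qed.

Lemma basis_op_tens j b v :
  basis_op gamma j (tens b v) = tens b (gamma j *m v).
Proof. exact: simple_op_tens. Qed.

(** Each group element is a joint eigenvector of all the [partial j], with its exponent sums as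
    eigenvalues. *)
Lemma diff_delta h : diff Omega (delta h) =
  \sum_j (exponent j h)%:~R *: lact Omega (delta h) (canonical_basis gamma j).
Proof.
apply/oper_inj; rewrite oper_sum /= dirac_commE; apply: eq_bigr => j _.
apply/funext; apply: tensor_ext => [||b v].
- exact/simple_op_linear/mulb.2.
(* The right side is again the operator of a one-form, hence linear. *)
- exact: (oper_linear (_ *: lact Omega _ (canonical_basis gamma j))).
rewrite simple_op_tens; last exact: mulb.2.
transitivity ((exponent j h)%:~R *:
  pi_op (delta h) (basis_op gamma j (tens b v))); last by [].
rewrite basis_op_tens pi_op_tens partial_delta -scalerAl.
by rewrite (linPZ ((tens_bilinear _ _).1 _)).
Qed.

(** A one-pair family for e_j, on which [left_coactionE] and [right_coactionE] evaluate the
    coactions. *)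
Lemma canonical_basisE j : canonical_basis gamma j =
  form_of Omega [:: (delta (free_gen j)^-1%g, delta (free_gen j))].
Proof. by apply/oper_inj; rewrite /form_of big_seq1 /= basis_opE. Qed.

(** * Components of a one-form *)

Section Component.
Variables (k : 'I_N) (j : 'I_n).

Let v0 : 'cV[K]_N := delta_mx k 0.

(** The slice map id (x) (k-th coordinate); it returns b on b (x) [v0]. *)
Definition entry : tensor A 'cV[K]_N -> A :=
  tlift (fun (b : A) (v : 'cV[K]_N) => v k 0 *: b).

Lemma entry_bilinear : is_bilinear (fun (b : A) (v : 'cV[K]_N) => v k 0 *: b).
Proof.
split=> [v c a b|b c u v] /=; first by rewrite scalerDr !scalerA mulrC.
by rewrite !mxE scalerDl scalerA.
Qed.

(* The anticommutator of [\sum_i a_i (x) gamma_i] with [e_j] is [2 a_j (x) 1]. *)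
Definition component (w : Omega) : A :=
  2^-1 *: entry (oper w (basis_op gamma j (tens 1 v0)) +
                 basis_op gamma j (oper w (tens 1 v0))).

Lemma component_linear : linear component.
Proof.
have le : linear entry := tlift_linear entry_bilinear.
have lb := basis_op_linear j.
move=> c u v; rewrite /component !operD !operZ lb addrACA -scalerDr.
by rewrite le scalerDr !scalerA mulrC.
Qed.

(** The Clifford relations and the invertibility of 2 enter here. *)
Lemma component_lact_diff a b :
    gamma_matrices gamma -> 2 != 0 :> K ->
  component (lact Omega a (diff Omega b)) = a * partial j b.
Proof.
move=> [gamma2 gammaN] two0.
have le : linear entry := tlift_linear entry_bilinear.
have lb := basis_op_linear j.
have wE v : oper (lact Omega a (diff Omega b)) (tens 1 v) =
    \sum_i tens (a * partial i b) (gamma i *m v).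
  rewrite /= dirac_commE fct_sumE (linP_sum (pi_op_linear a)).
  apply: eq_bigr => i _; rewrite simple_op_tens; last exact: mulb.2.
  by rewrite pi_op_tens mulr1.
rewrite /component basis_op_tens !wE (linP_sum lb).
(* The term i = j gives twice the coefficient, which [2^-1] corrects; in every other term the two
   orders of the gamma matrices have opposite signs. *)
rewrite -big_split (linP_sum le) (bigD1 j) //= big1 ?addr0 => [|i ij].
  rewrite basis_op_tens mulmxA gamma2 mul1mx.
  rewrite (linPD le) /entry tlift_tens; last exact: entry_bilinear.
  by rewrite mxE !eqxx scale1r -mulr2n -scaler_nat scalerA mulVf ?scale1r.
rewrite basis_op_tens (linPD le) /entry.
rewrite !tlift_tens; try exact: entry_bilinear.
by rewrite -scalerDl !mulmxA (gammaN _ _ ij) mulNmx !mxE addNr scale0r.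
Qed.
End Component.

(** * Covariance, checked on group elements *)

Local Notation H := (group_hopf K (free_group n)).

Lemma comult_delta g : H (delta g) = tens (delta g) (delta g).
Proof. exact: glin_delta. Qed.

Let lH : linear (@group_comult K (free_group n)) := comult_linear H.

(** The summand of [left_sum], isolated as a bilinear map so that it is determined by its values on
    group elements; [right_term] does the same for [right_sum]. *)
Definition left_term (a b : A) : tensor A Omega :=
  tprod (fun x y => x * y) (lact Omega)
    (H a) (tmap idfun (diff Omega) (H b)).

Definition right_term (a b : A) : tensor Omega A :=
  tprod (lact Omega) (fun x y => x * y)
    (H a) (tmap (diff Omega) idfun (H b)).

Lemma left_term_bilinear : is_bilinear left_term.
Proof.
have bt := tprod_bilinear mulb lactb.
split=> [b c u v|a c u v]; rewrite /left_term /=.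
  by rewrite lH (bt.1 _).
by rewrite lH tmap_linear ?(bt.2 _).
Qed.

Lemma right_term_bilinear : is_bilinear right_term.
Proof.
have bt := tprod_bilinear lactb mulb.
split=> [b c u v|a c u v]; rewrite /right_term /=.
  by rewrite lH (bt.1 _).
by rewrite lH tmap_linear ?(bt.2 _).
Qed.

Lemma left_term_delta g h : left_term (delta g) (delta h) =
  tens (delta (g * h)%g) (lact Omega (delta g) (diff Omega (delta h))).
Proof.
by rewrite /left_term !comult_delta tmap_tens // tprod_tens // deltaM.
Qed.

Lemma right_term_delta g h : right_term (delta g) (delta h) =
  tens (lact Omega (delta g) (diff Omega (delta h))) (delta (g * h)%g).
Proof.
by rewrite /right_term !comult_delta tmap_tens // tprod_tens // deltaM.
Qed.

(** Apart from the scalar [exponent j h], everything depends on the product gh alone; this is the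
    shape that [graded_term] asks for. *)
Lemma lact_diff_delta g h :
  lact Omega (delta g) (diff Omega (delta h)) =
  \sum_j (exponent j h)%:~R *:
    lact Omega (delta (g * h)%g) (canonical_basis gamma j).
Proof.
rewrite diff_delta (linP_sum (lactb.2 _)); apply: eq_bigr => j _.
by rewrite (linPZ (lactb.2 _)) -deltaM (lactM bimod).
Qed.

Lemma bilinear_ext (V : lmodType K) (f h : A -> A -> V) :
  is_bilinear f -> is_bilinear h ->
  (forall x y, f (delta x) (delta y) = h (delta x) (delta y)) ->
  forall a b, f a b = h a b.
Proof.
move=> bf bh fh a b; apply: (glin_ext (bf.1 b) (bh.1 b)) => x.
by apply: (glin_ext (bf.2 _) (bh.2 _)) => y.
Qed.

(** On group elements [a * partial j b] is [exponent j h] times [delta (g * h)]. Thus [f] sees a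
    pair only through the components of a d(b). *)
Lemma graded_term (V : lmodType K) (phi : 'I_n -> free_group n -> V)
    (f : A -> A -> V) : is_bilinear f ->
    (forall g h, f (delta g) (delta h) =
       \sum_j (exponent j h)%:~R *: phi j (g * h)%g) ->
  forall a b, f a b = \sum_j glin (phi j) (a * partial j b).
Proof.
move=> bf fE; apply: (bilinear_ext bf) => [|g h].
  split=> [b c u v|a c u v]; rewrite scaler_sumr -big_split;
    apply: eq_bigr => j _ /=.
    by rewrite (mulb.1 _) glin_linear.
  by rewrite partial_linear (mulb.2 _) glin_linear.
rewrite fE; apply: eq_bigr => j _.
rewrite partial_delta -scalerAr deltaM (linPZ (glin_linear _)).
by rewrite glin_delta.
Qed.

Hypotheses (gammaP : gamma_matrices gamma) (two0 : 2 != 0 :> K).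

(** Common core of both covariances. The index [k] is the coordinate in which [component] reads a
    form; any one will do. *)
Lemma graded_sum_eq0 (k : 'I_N) (V : lmodType K)
    (phi : 'I_n -> free_group n -> V) (f : A -> A -> V) : is_bilinear f ->
    (forall g h, f (delta g) (delta h) =
       \sum_j (exponent j h)%:~R *: phi j (g * h)%g) ->
  forall s, form_of Omega s = 0 -> \sum_(p <- s) f p.1 p.2 = 0.
Proof.
move=> bf fE s s0; under eq_bigr do rewrite (graded_term bf fE).
(* Summing over the family first leaves, for each j, one linear map applied to the j-th component of
   the whole form. *)
rewrite exchange_big big1 // => j _.
rewrite -(linP_sum (glin_linear _)).
under eq_bigr do rewrite -(component_lact_diff k j _ _ gammaP two0).
rewrite -(linP_sum (component_linear k j)) -/(form_of Omega s) s0.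
by rewrite (linP0 (component_linear k j)) (linP0 (glin_linear _)).
Qed.

Lemma canonical_left_covariant (k : 'I_N) : left_covariant H Omega.
Proof.
apply: (graded_sum_eq0 k left_term_bilinear (phi := fun j g =>
  tens (delta g) (lact Omega (delta g) (canonical_basis gamma j)))) => g h.
rewrite left_term_delta lact_diff_delta (linP_sum ((tens_bilinear _ _).2 _)).
by apply: eq_bigr => j _; rewrite (linPZ ((tens_bilinear _ _).2 _)).
Qed.

Lemma canonical_right_covariant (k : 'I_N) : right_covariant H Omega.
Proof.
apply: (graded_sum_eq0 k right_term_bilinear (phi := fun j g =>
  tens (lact Omega (delta g) (canonical_basis gamma j)) (delta g))) => g h.
rewrite right_term_delta lact_diff_delta (linP_sum ((tens_bilinear _ _).1 _)).
by apply: eq_bigr => j _; rewrite (linPZ ((tens_bilinear _ _).1 _)).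
Qed.

Lemma canonical_basis_left (k : 'I_N) j :
  left_invariant H (canonical_basis gamma j).
Proof.
rewrite /left_invariant {1}canonical_basisE.
have cov := canonical_left_covariant k.
rewrite (left_coactionE canonical_differential _ cov).
(* The group-like leg is the product of the inverse generator and the generator, that is, the
   unit. *)
rewrite /left_sum big_seq1 [LHS]left_term_delta mulVg.
by rewrite canonical_basisE /form_of big_seq1.
Qed.

Lemma canonical_basis_right (k : 'I_N) j :
  right_invariant H (canonical_basis gamma j).
Proof.
rewrite /right_invariant {1}canonical_basisE.
have cov := canonical_right_covariant k.
rewrite (right_coactionE canonical_differential _ cov).
rewrite /right_sum big_seq1 [LHS]right_term_delta mulVg.
by rewrite canonical_basisE /form_of big_seq1.
Qed.
End FirstOrder.

Theorem theorem4p2 (R : realType) (n : nat) (n_ge1 : (1 <= n)%N)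
    (gamma : 'I_n -> 'M[R[i]]_(2 ^ n./2)) (gammaP : gamma_matrices gamma) :
  let H := group_hopf R[i] (free_group n) in
  let Omega := canonical_calculus gamma in
  [/\ is_differential_calculus Omega,
      bicovariant H Omega &
      forall i : 'I_n, left_invariant H (canonical_basis gamma i) /\
                       right_invariant H (canonical_basis gamma i)].
Proof.
(* The spinor space is nonzero, so there is a coordinate in which to read components. *)
have k : 'I_(2 ^ n./2) by apply: (@Ordinal _ 0); rewrite expn_gt0.
have two0 : 2 != 0 :> R[i] by rewrite Num.Theory.pnatr_eq0.
split; first exact: canonical_differential.
  split; first exact: (canonical_left_covariant gammaP two0 k).
  exact: (canonical_right_covariant gammaP two0 k).
move=> j; split; first exact: (canonical_basis_left gammaP two0 k).
exact: (canonical_basis_right gammaP two0 k).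
Qed.
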